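(* For $n\ge 1$ let $S_n$ be the star graph consisting of a central vertex adjacent to $n$ vertices of degree one, with the standard price function ($P\equiv 2$). Then for every fixed integer $t\ge 1$, \[ \lim_{n\to\infty}\frac{\pi^{t+1}(S_n)}{\pi^{t}(S_n)}=1. \]
   Context: A configuration of $k$ pebbles on a graph $G$ is a function $C:V(G)\to\mathbb{Z}_{\ge0}$ with total sum $k$. A pebbling move along an edge $uv$ removes two pebbles from $u$ and adds one pebble to $v$ (allowed only if $u$ has at least two pebbles). A configuration is $t$-solvable if for every set of $t$ vertices some sequence of pebbling moves yields a configuration with at least one pebble on each of those $t$ vertices. $\pi^t(G)$ is the minimum $k$ such that every configuration of $k$ pebbles on $G$ is $t$-solvable. In the paper this is phrased as: the pebbling ratio sequence $\alpha^t(\mathcal{S})$ of the family of star graphs converges to $1$ for all $t$. *)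

(* Defs.v *)
From mathcomp Require Import all_boot all_order all_algebra.
From mathcomp Require Import all_classical all_reals all_analysis.
Import Order.TTheory GRing.Theory Num.Theory.
Import numFieldNormedType.Exports.

Set Implicit Arguments.
Unset Strict Implicit.
Unset Printing Implicit Defensive.

Local Open Scope nat_scope.

Record sgraph := SGraph {
  vertex :> finType;
  adj : rel vertex;
  adj_sym : symmetric adj;
  adj_irr : irreflexive adj }.

Definition config (G : sgraph) := {ffun G -> nat}.

Definition pebbles (G : sgraph) (C : config G) : nat := \sum_(v : G) C v.

(* The price function is constantly 2: a move costs two pebbles at [u] and
   delivers one at [v].  The subtraction is exact, because [u] holds at least
   two pebbles. *)
Definition move_along (G : sgraph) (C : config G) (u v : G) : config G :=
  [ffun w => (C w - (if w == u then 2 else 0)) + (if w == v then 1 else 0)].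

Definition pebbling_move (G : sgraph) : rel (config G) := fun C C' =>
  [exists u : G, exists v : G,
     [&& adj u v, 2 <= C u & C' == move_along C u v]].

Definition reachable (G : sgraph) (C C' : config G) : Prop :=
  exists2 s : seq (config G), path (@pebbling_move G) C s & C' = last C s.

Definition solvable (G : sgraph) (t : nat) (C : config G) : Prop :=
  forall A : {set G}, #|A| = t ->
    exists2 C' : config G, reachable C C' & forall v, v \in A -> 0 < C' v.

Definition all_solvable (G : sgraph) (t k : nat) : Prop :=
  forall C : config G, pebbles C = k -> solvable t C.

Definition is_pebbling_number (G : sgraph) (t k : nat) : Prop :=
  all_solvable G t k /\ forall j, all_solvable G t j -> k <= j.

(* The default value 0 is used only when no number of pebbles suffices, which
   cannot happen in a connected graph. *)
Definition pebbling_number (t : nat) (G : sgraph) : nat :=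
  xget 0 (is_pebbling_number G t).

(* The centre is [None]; the leaves are the [Some i]. *)
Definition star_adj (n : nat) : rel (option 'I_n) :=
  fun x y => isSome x != isSome y.

Lemma star_adj_sym n : symmetric (@star_adj n).
Proof. by move=> x y; rewrite /star_adj eq_sym. Qed.

Lemma star_adj_irr n : irreflexive (@star_adj n).
Proof. by move=> x; rewrite /star_adj eqxx. Qed.

Definition star (n : nat) : sgraph :=
  SGraph (@star_adj_sym n) (@star_adj_irr n).

(* Main.v *)
Require Import Defs.
From mathcomp Require Import all_boot all_order all_algebra.
From mathcomp Require Import all_classical all_reals all_analysis.
From mathcomp Require Import zify.
Import Order.TTheory GRing.Theory Num.Theory.
Import numFieldNormedType.Exports.

Set Implicit Arguments.
Unset Strict Implicit.
Unset Printing Implicit Defensive.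

(** For [1 <= t <= n] one has [n <= pi^t(S_n) <= n + 4 t + 2], so consecutive
    pebbling numbers differ by a bounded amount while growing linearly in [n].
    Lower bound: with single pebbles on [k < n + 1] distinct vertices no move is
    possible and some vertex is empty.  Upper bound: moving from a leaf to the centre
    preserves (number of pebbles) + (pebbles on the centre), and such a move
    exists as soon as the leaves carry more than [n] pebbles; this collects
    [2 t + 1] pebbles on the centre, from which [t] vertices can be covered. *)

Local Open Scope nat_scope.

Lemma reachable_refl (G : sgraph) (C : config G) : reachable C C.
Proof. by exists [::]. Qed.

Lemma reachable_trans (G : sgraph) (C2 C1 C3 : config G) :
  reachable C1 C2 -> reachable C2 C3 -> reachable C1 C3.
Proof.
move=> [s1 p1 ->] [s2 p2 ->]; exists (s1 ++ s2); last by rewrite last_cat.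
by rewrite cat_path p1.
Qed.

Lemma reachable_move (G : sgraph) (C : config G) (u v : G) :
  adj u v -> 2 <= C u -> reachable C (move_along C u v).
Proof.
move=> uv Cu; exists [:: move_along C u v] => //=; rewrite andbT.
by apply/existsP; exists u; apply/existsP; exists v; rewrite uv Cu /=.
Qed.

Lemma reachable_stuck (G : sgraph) (C C' : config G) :
  (forall u, C u <= 1) -> reachable C C' -> C' = C.
Proof.
move=> C1 [[|D s] //= /andP[/existsP[u /existsP[v /and3P[_ Cu _]]] _] _].
by have := leq_trans Cu (C1 u).
Qed.

Lemma pebbles_move (G : sgraph) (C : config G) (u v : G) :
  2 <= C u -> (pebbles (move_along C u v)).+1 = pebbles C.
Proof.
move=> Cu.
have sum_at (x : G) k : \sum_(w : G) (if w == x then k else 0) = k.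
  by rewrite -big_mkcond big_pred1_eq.
(* Adding the two spent pebbles back on the left gives an identity without truncated subtraction,
   which can be summed vertex by vertex. *)
have : \sum_w (move_along C u v w + (if w == u then 2 else 0))
     = \sum_w (C w + (if w == v then 1 else 0)).
  by apply: eq_bigr => w _; rewrite ffunE; case: (w =P u) => [->|_]; lia.
by rewrite !big_split !sum_at /= /pebbles; lia.
Qed.

(** Pigeonhole: [n] leaves with at most one pebble each carry at most [n] in all. *)
Lemma star_heavy_leaf n (C : config (star n)) :
  n + C None < pebbles C -> exists i, 2 <= C (Some i).
Proof.
move=> nC; apply/existsP; apply: contraLR nC; rewrite negb_exists => /forallP C1.
rewrite -leqNgt /pebbles (bigD1 None) //= addnC leq_add2r.
apply: (@leq_trans (\sum_(v : star n | v != None) 1)).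
  by apply: leq_sum => -[i _|//]; rewrite leqNgt; exact: C1.
by rewrite sum1_card cardC1 card_option card_ord.
Qed.

Lemma star_collect n k (C : config (star n)) :
  n + k.*2 <= pebbles C + C None ->
  exists2 C' : config (star n), reachable C C' & k <= C' None.
Proof.
(* Induction on the deficit [d] of the centre. While [C None < k], the hypothesis gives
   [n + C None < pebbles C], so some leaf can pay for a move. *)
move: {-1}(k - C None) (erefl (k - C None)) => d.
elim: d C => [|d IHd] C dE Ck.
  by exists C; [exact: reachable_refl | lia].
have [|i Ci] := @star_heavy_leaf n C; first by lia.
have DN : move_along C (Some i : star n) None None = (C None).+1.
  by rewrite ffunE /=; lia.
have [||C' DC' kC'] := IHd (move_along C (Some i : star n) None).
- by rewrite DN; lia.
- by have := pebbles_move (None : star n) Ci; rewrite DN; lia.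
exists C' => //; apply: reachable_trans DC'; exact: reachable_move.
Qed.

(** Each empty target costs two pebbles of the centre. The strict inequality keeps one pebble there
    throughout, so the centre is never an empty target itself. *)
Lemma star_cover n (A : {set star n}) (C : config (star n)) :
  #|[set v in A | C v == 0]|.*2 < C None ->
  exists2 C' : config (star n), reachable C C' & forall v, v \in A -> 0 < C' v.
Proof.
move: {-1}#|_| (erefl #|[set v in A | C v == 0]|) => m.
elim: m C => [|m IHm] C mE mC.
  exists C; first exact: reachable_refl.
  move=> v vA; have /setP/(_ v) := cards0_eq mE.
  by rewrite !inE vA /= lt0n => ->.
have /card_gt0P[v] : 0 < #|[set v in A | C v == 0]| by rewrite mE.
rewrite inE => /andP[vA /eqP Cv0].
case: v vA Cv0 => [i|] vA Cv0; last by rewrite Cv0 in mC.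
pose D := move_along C (None : star n) (Some i).
have DN : D None = C None - 2 by rewrite ffunE /=; lia.
have C3 : 2 < C None by lia.
(* As [C None] exceeds 2, the centre stays occupied after the move, and [Some i] is the only vertex
   to leave the set of empty targets. *)
have emptyD : [set v in A | D v == 0] = [set v in A | C v == 0] :\ (Some i : star n).
  apply/setP => w; rewrite !inE /D ffunE.
  case: w => [j|] /=; last first.
    by rewrite addn0 subn_eq0 leqNgt C3 gtn_eqF // (ltn_trans _ C3).
  by rewrite subn0; case: (_ == Some i); rewrite ?addn0 // addn1 andbF.
have [||C' DC' AC'] := IHm D; last 1 first.
- exists C' => //; apply: reachable_trans DC'.
  by apply: reachable_move; last exact: ltnW.
- have := cardsD1 (Some i : star n) [set v in A | C v == 0].
  by rewrite mE -emptyD !inE vA Cv0 eqxx /=; lia.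
- by rewrite DN; lia.
Qed.

(** Collecting [k = 2t + 1] pebbles on the centre takes [n + 2k]; at most [t] targets are then
    empty, and [2t < k]. *)
Lemma star_all_solvable n t : all_solvable (star n) t (n + t.*2.+1.*2).
Proof.
move=> C Cn A At.
have [|D CD tD] := @star_collect n t.*2.+1 C; first by rewrite Cn leq_addr.
have [|C' DC' AC'] := @star_cover n A D.
  apply: leq_trans tD; rewrite ltnS leq_double -At.
  by apply: subset_leq_card; rewrite finset.setIdE finset.subsetIl.
by exists C' => //; exact: reachable_trans DC'.
Qed.

Lemma exists_subset_card (T : finType) (B : {set T}) k :
  k <= #|B| -> exists2 A : {set T}, A \subset B & #|A| = k.
Proof.
rewrite -bin_gt0 -cards_draws => /card_gt0P[A].
by rewrite inE => /andP[AB /eqP Ak]; exists A.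
Qed.

Lemma all_solvable_ge (G : sgraph) t k :
  0 < t <= #|G| -> all_solvable G t k -> #|G| <= k.
Proof.
move=> /andP[t0 tG] solk; rewrite leqNgt; apply/negP => kG.
have [|S _ Sk] := @exists_subset_card G [set: G] k; first by rewrite cardsT ltnW.
have /card_gt0P[v] : 0 < #|~: S| by rewrite cardsCs finset.setCK Sk subn_gt0.
rewrite inE => vS.
(* The vertex [v] missed by [S] is completed to a target set of size [t], which the immobile
   configuration [C] fails to cover. *)
have [|B Bv Bt] := @exists_subset_card G [set~ v] t.-1.
  by rewrite cardsC1 -!subn1 leq_sub2r.
pose C : config G := [ffun w => nat_of_bool (w \in S)].
have Ck : pebbles C = k.
  rewrite -Sk -sum1_card [RHS]big_mkcond; apply: eq_bigr => w _.
  by rewrite ffunE; case: (w \in S).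
have [|C' CC' AC'] := solk C Ck (v |: B).
  rewrite cardsU1 Bt; case: (boolP (v \in B)) => [/(fintype.subsetP Bv)|_].
    by rewrite !inE eqxx.
  by rewrite add1n prednK.
have := AC' v; rewrite finset.setU11 (reachable_stuck _ CC').
  by rewrite ffunE (negbTE vS) => /(_ isT).
by move=> w; rewrite ffunE leq_b1.
Qed.

(** Once some number suffices, a least one exists, so [xget] does not return its default 0. *)
Lemma pebbling_numberP (G : sgraph) t k :
  all_solvable G t k -> is_pebbling_number G t (pebbling_number t G).
Proof.
move=> solk; pose P k := `[< all_solvable G t k >].
have exP : exists k, P k by exists k; apply/asboolP.
have [m /asboolP Pm mmin] := ex_minnP exP.
apply: (@xgetPex _ 0 (is_pebbling_number G t)); exists m.
by split=> // j /asboolP; exact: mmin.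
Qed.

Lemma pebbling_number_star n t : 0 < t <= n ->
  n <= pebbling_number t (star n) <= n + t.*2.+1.*2.
Proof.
move=> tn; have [solp minp] := pebbling_numberP (@star_all_solvable n t).
have nG : #|star n| = n.+1 by rewrite card_option card_ord.
rewrite minp ?andbT; last exact: star_all_solvable.
by apply: ltnW; rewrite -nG; apply: all_solvable_ge solp; rewrite nG; lia.
Qed.

Local Open Scope classical_set_scope.
Local Open Scope ring_scope.

Theorem theorem19 (R : realType) (t : nat) (ht : (1 <= t)%N) :
  ((pebbling_number t.+1 (star n))%:R / (pebbling_number t (star n))%:R : R)
    @[n --> \oo] --> (1 : R).
Proof.
(* The excess over [n] allowed for [t.+1] also dominates the one for [t], so both pebbling numbers
   lie between [n] and [n + b]. *)
pose b := (t.+1).*2.+1.*2.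
apply/cvgrPdist_le => e e0; near=> n.
have tn : (t.+1 <= n)%N by near: n; exact: nbhs_infty_ge.
have /andP[np pb] : (n <= pebbling_number t (star n) <= n + t.*2.+1.*2)%N.
  by apply: pebbling_number_star; rewrite ht ltnW.
have /andP[nq qb] : (n <= pebbling_number t.+1 (star n) <= n + b)%N.
  exact: pebbling_number_star.
set p := pebbling_number t _ in np pb *; set q := pebbling_number _ _ in nq qb *.
have n_large : b%:R / e <= n%:R by near: n; exact: nbhs_infty_ger.
have p0 : 0 < p%:R :> R by rewrite ltr0n; lia.
have -> : 1 - q%:R / p%:R = (p%:R - q%:R) / p%:R :> R.
  by rewrite mulrBl divff ?gt_eqF.
rewrite normrM normfV (gtr0_norm p0) ler_pdivrMr //.
(* The numerator is at most [b] in absolute value, and [b <= e * p] because [b / e <= n <= p]. *)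
apply: (@le_trans _ _ b%:R).
  have qp : q%:R <= p%:R + b%:R :> R by rewrite -natrD ler_nat; lia.
  have pq : p%:R <= q%:R + b%:R :> R by rewrite -natrD ler_nat; lia.
  by rewrite ler_norml lerBlDl lerBrDr addrC lerBlDr pq qp.
rewrite mulrC -ler_pdivrMr //; apply: le_trans n_large _.
by rewrite ler_nat.
Unshelve. all: by end_near. Qed.
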